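(* Let $G$ be a compact group and $n\ge1$. Then $d^{(n+1)}(G)\le\frac{1}{2^n}\big(2^n-1+d(G/Z_n(G))\big)$.
   Context: For a compact group $X$, $\mu_X$ denotes its normalized Haar measure and $\mu_X^m$ the product measure on $X^m$. $Z_n(G)$ is the $n$-th term of the upper central series of $G$ ($Z_0(G)=1$, $Z_{i+1}(G)/Z_i(G)=Z(G/Z_i(G))$); it is closed and normal. Commutators: $[x,y]=x^{-1}y^{-1}xy$, $[x_1,\dots,x_{k+1}]=[[x_1,\dots,x_k],x_{k+1}]$. For a compact group $X$ and $m\ge1$, $d^{(m)}(X)=\mu_X^{m+1}(\{(x_1,\dots,x_{m+1})\in X^{m+1}: [x_1,\dots,x_{m+1}]=1\})$, and $d(X)=d^{(1)}(X)$. *)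

(* Defs.v *)
From HB Require Import structures.
From mathcomp Require Import all_boot all_order all_algebra.
From mathcomp Require Import all_classical all_reals all_analysis.

Set Implicit Arguments.
Unset Strict Implicit.
Unset Printing Implicit Defensive.

Import Order.TTheory GRing.Theory Num.Theory.
Local Open Scope classical_set_scope.
Local Open Scope ring_scope.

Definition borel (T : topologicalType) : set (set T) := <<s (@open T) >>.

Record compact_group (G : topologicalType) (mul : G -> G -> G) (inv : G -> G)
    (e : G) : Prop := CompactGroup {
  cg_assoc : forall x y z, mul x (mul y z) = mul (mul x y) z;
  cg_mul1g : forall x, mul e x = x;
  cg_mulVg : forall x, mul (inv x) x = e;
  cg_mul_cont : continuous (fun p : G * G => mul p.1 p.2);
  cg_inv_cont : continuous inv;
  cg_hausdorff : hausdorff_space G;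
  cg_compact : compact [set: G] }.

Record haar_prob (R : realType) (T : topologicalType) (mul : T -> T -> T)
    (mu : set T -> \bar R) : Prop := HaarProb {
  hp_ge0 : forall A, borel A -> (0 <= mu A)%E;
  hp_sigma_additive : forall F : nat -> set T, (forall i, borel (F i)) ->
     trivIset setT F ->
     (fun k => \sum_(0 <= i < k) mu (F i))%E @ \oo --> mu (\bigcup_i F i);
  hp_setT : mu setT = 1%E;
  hp_left_invariant : forall g A, borel A -> mu (mul g @` A) = mu A;
  hp_outer_regular : forall A, borel A ->
     mu A = ereal_inf [set mu U | U in [set U | open U /\ A `<=` U]];
  hp_inner_regular : forall U, open U ->
     mu U = ereal_sup [set mu K | K in [set K | compact K /\ K `<=` U]] }.

Section Commutators.
Variables (G : Type) (mul : G -> G -> G) (inv : G -> G) (e : G).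

Definition comm (x y : G) : G := mul (mul (inv x) (inv y)) (mul x y).

Fixpoint itcomm (k : nat) (x : nat -> G) : G :=
  match k with
  | 0 => x 0%N
  | k'.+1 => comm (itcomm k' x) (x k)
  end.

(** Upper central series: Z_0 = 1, x \in Z_{i+1} iff [x,y] \in Z_i for all y
    (i.e. x Z_i is central in G / Z_i). *)
Fixpoint upper_central (n : nat) : set G :=
  match n with
  | 0 => [set e]
  | n'.+1 => [set x | forall y, upper_central n' (comm x y)]
  end.

End Commutators.

Definition pw_mul (G : Type) (k : nat) (mul : G -> G -> G) :
  {ptws 'I_k -> G} -> {ptws 'I_k -> G} -> {ptws 'I_k -> G} :=
  fun f g i => mul (f i) (g i).

Definition comm_trivial_set (G : Type) (mul : G -> G -> G) (inv : G -> G) (e : G)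
  (m : nat) : set {ptws 'I_m.+1 -> G} :=
  [set x | itcomm mul inv m (fun k => x (inord k)) = e].
Arguments comm_trivial_set {G} mul inv e m _.
Arguments pw_mul {G} {k} mul _ _ _.

(* Main.v *)
Require Import Defs.
From HB Require Import structures.
From mathcomp Require Import all_boot all_order all_algebra.
From mathcomp Require Import all_classical all_reals all_analysis.
From mathcomp Require Import lra zify.
Import Order.TTheory GRing.Theory Num.Theory.
Local Open Scope classical_set_scope.
Local Open Scope ring_scope.

Set Implicit Arguments.
Unset Strict Implicit.
Unset Printing Implicit Defensive.

(** Let [A_k] be the set of tuples whose commutator of length [n + 2 - k] lies
    in [Z_k]. If a commutator [c] of length [n + 1 - k] is not in [Z_(k+1)],
    some [g] has [[c, g]] outside [Z_k], and translating the next coordinate by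
    [g] moves the tuples of [A_k] above [c] off [A_k]. Such a [g] works on an
    open set of tuples, so finitely many [g] suffice up to small measure by
    inner regularity; this gives [mu A_k <= (1 + mu A_(k+1)) / 2] without
    Fubini's theorem. Iterating reduces the claim to [A_n], which is the
    preimage of the commuting pairs of [Q] under a surjective morphism.

    It remains to compare the pushforward [nu] of Haar measure with the Haar
    measure [mu] of [Q * Q]. For [C] closed inside [U] open, packing
    finitely many rectangles [E_i * (y_i C)], with the [E_i] partitioning the
    group, into [{(z, x) | z^-1 x \in U}] yields [nu C <= mu U^-1].
    Taking [nu = mu] and using inner regularity, [mu U^-1 = mu U]; outer
    regularity then gives [nu C <= mu C]. *)

(** * Finite subcovers and maps into product spaces *)

Section Topology.

(** Compactness in near-covering form, applied to lists of indices directed by inclusion, yields the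
    finite subcover as a list, ready for induction. *)
Lemma compact_seq_cover (T : topologicalType) (K : set T) (I : eqType)
    (O : I -> set T) :
  compact K -> (forall i, open (O i)) ->
  (forall x, K x -> exists i, O i x) ->
  exists s : seq I, forall x, K x -> exists2 i, i \in s & O i x.
Proof.
move=> /compact_near_coveringP cK oO KO.
(* [F] expresses that a property holds for every sufficiently large list. *)
pose F : set_system (seq I) :=
  [set P : set (seq I) |
     exists s0 : seq I, forall s : seq I, {subset s0 <= s} -> P s].
have FF : Filter F.
  split; first by exists [::].
    move=> P P' [s Ps] [s' Ps']; exists (s ++ s') => t st.
    by split; [apply: Ps|apply: Ps'] => i si; apply: st;
       rewrite mem_cat si ?orbT.
  by move=> P P' PP' [s Ps]; exists s => t /Ps /PP'.
have [x Kx|s0 +] := cK _ F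
    (fun (s : seq I) x => exists2 i, i \in s & O i x) FF.
  have [i Oix] := KO x Kx; exists (O i, [set s : seq I | i \in s]) => /=.
    split; first exact: open_nbhs_nbhs.
    by exists [:: i] => s; apply; rewrite mem_head.
  by move=> [y s] [/= Oiy si]; exists i.
by move=> /(_ s0 (fun _ => id)) Ks0; exists s0.
Qed.

Lemma continuous_to_ptws (X T : topologicalType) (I : eqType)
    (f : X -> {ptws I -> T}) :
  (forall i, continuous (fun x => f x i)) -> continuous f.
Proof.
move=> fi x; apply/cvg_sup => i.
apply: (@continuous_comp_initial _ X T (fun g : I -> T => g i)).
exact: fi.
Qed.

Lemma ptws_coord_continuous (T : topologicalType) (I : eqType) (i : I) :
  continuous (fun f : {ptws I -> T} => f i).
Proof. exact: (@proj_continuous I (fun=> T) i). Qed.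

End Topology.

(** * Borel sets *)

Section Borel.
Variable T : topologicalType.
Implicit Types A B : set T.

Lemma borel_open A : open A -> borel A.
Proof. exact: sub_sigma_algebra. Qed.

Lemma borel0 : borel (@set0 T).
Proof. exact: sigma_algebra0. Qed.

Lemma borelC A : borel A -> borel (~` A).
Proof. by move=> bA; rewrite -setTD; exact: sigma_algebraCD. Qed.

Lemma borelT : borel (@setT T).
Proof. by rewrite -setC0; apply: borelC; exact: borel0. Qed.

Lemma borel_closed A : closed A -> borel A.
Proof. by move=> /closed_openC /borel_open /borelC; rewrite setCK. Qed.

Lemma borelU A B : borel A -> borel B -> borel (A `|` B).
Proof.
by move=> bA bB; rewrite -bigcup2E; apply: sigma_algebra_bigcup => -[|[|i]] //=;
   exact: borel0.
Qed.

Lemma borelI A B : borel A -> borel B -> borel (A `&` B).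
Proof.
move=> bA bB; rewrite -[A]setCK -[B]setCK -setCU.
by apply: borelC; apply: borelU; exact: borelC.
Qed.

Lemma borelD A B : borel A -> borel B -> borel (A `\` B).
Proof. by move=> bA bB; apply: borelI => //; exact: borelC. Qed.

End Borel.

(** The sets with Borel preimage form a sigma-algebra containing the open sets. *)
Lemma borel_preimage (S T : topologicalType) (f : S -> T) (A : set T) :
  continuous f -> borel A -> borel (f @^-1` A).
Proof.
move=> cf bA; apply: (bA [set B | borel (f @^-1` B)]); split; last first.
  by move=> B oB; apply: borel_open; exact: (continuousP f).1 cf B oB.
split=> [|B bB|B bB] /=.
- by rewrite preimage_set0; exact: borel0.
- by rewrite setTD preimage_setC; exact: borelC.
- by rewrite preimage_bigcup; exact: sigma_algebra_bigcup.
Qed.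

(** * Algebra and continuity in a compact group *)

Section CompactGroup.
Context {T : topologicalType} {mul : T -> T -> T} {inv : T -> T} {e : T}.
Hypothesis hT : compact_group mul inv e.

Lemma cg_mulKg x y : mul (inv x) (mul x y) = y.
Proof. by rewrite (cg_assoc hT) (cg_mulVg hT) (cg_mul1g hT). Qed.

Lemma cg_mulgI x y z : mul x y = mul x z -> y = z.
Proof. by move=> /(congr1 (mul (inv x))); rewrite !cg_mulKg. Qed.

Lemma cg_mulg1 x : mul x e = x.
Proof. by apply: (@cg_mulgI (inv x)); rewrite cg_mulKg (cg_mulVg hT). Qed.

Lemma cg_mulgV x : mul x (inv x) = e.
Proof.
by apply: (@cg_mulgI (inv x)); rewrite cg_mulKg cg_mulg1.
Qed.

Lemma cg_mulKVg x y : mul x (mul (inv x) y) = y.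
Proof. by rewrite (cg_assoc hT) cg_mulgV (cg_mul1g hT). Qed.

Lemma cg_invK x : inv (inv x) = x.
Proof. by apply: (@cg_mulgI (inv x)); rewrite cg_mulgV (cg_mulVg hT). Qed.

Lemma cg_invM x y : inv (mul x y) = mul (inv y) (inv x).
Proof.
apply: (@cg_mulgI (mul x y)).
by rewrite cg_mulgV -(cg_assoc hT) cg_mulKVg cg_mulgV.
Qed.

Lemma cg_inv1 : inv e = e.
Proof. by rewrite -[LHS](cg_mul1g hT) cg_mulgV. Qed.

Lemma cg_mulgA x y z : mul (mul x y) z = mul x (mul y z).
Proof. by rewrite (cg_assoc hT). Qed.

(* A complete rewriting system for the word problem in free groups. *)
Definition cg_simp := (cg_mulgA, cg_mulKg, cg_mulKVg, cg_mulgV, cg_mulVg hT,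
  cg_invM, cg_invK, cg_inv1, cg_mulg1, cg_mul1g hT).

Lemma cg_image_mul g (A : set T) : mul g @` A = mul (inv g) @^-1` A.
Proof.
apply/seteqP; split=> [_ [x Ax <-]|x Ax] /=; first by rewrite cg_mulKg.
by exists (mul (inv g) x); rewrite ?cg_mulKVg.
Qed.

Lemma continuous_mul (X : topologicalType) (f g : X -> T) :
  continuous f -> continuous g -> continuous (fun x => mul (f x) (g x)).
Proof.
move=> cf cg x; apply: continuous2_cvg; [|exact: cf|exact: cg].
exact: (@cg_mul_cont _ _ _ _ hT (f x, g x)).
Qed.

Lemma continuous_inv (X : topologicalType) (f : X -> T) :
  continuous f -> continuous (fun x => inv (f x)).
Proof.
by move=> cf x; apply: continuous_comp; [exact: cf|exact: cg_inv_cont hT _].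
Qed.

Lemma continuous_comm (X : topologicalType) (f g : X -> T) :
  continuous f -> continuous g ->
  continuous (fun x => comm mul inv (f x) (g x)).
Proof.
by move=> cf cg; do 2?[apply: continuous_mul]; do ?exact: continuous_inv.
Qed.

Lemma borel_image_mul g (A : set T) : borel A -> borel (mul g @` A).
Proof.
move=> bA; rewrite cg_image_mul; apply: borel_preimage => //.
apply: (@continuous_mul T (fun=> inv g) id) => x; last exact: cvg_id.
exact: cst_continuous.
Qed.

Lemma cg_compact_closed (K : set T) : compact K -> closed K.
Proof. by apply: compact_closed; exact: cg_hausdorff hT. Qed.

Lemma cg_closed_compact (K : set T) : closed K -> compact K.
Proof. by move=> cK; exact: (subclosed_compact cK (cg_compact hT)). Qed.

End CompactGroup.

(* Finite additivity suffices once regularity of the Haar measure has been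
   used. *)
Record borel_invariant_prob (R : realType) (T : topologicalType)
    (mul : T -> T -> T) (m : set T -> R) : Prop := BorelInvariantProb {
  bip_ge0 : forall A, borel A -> 0 <= m A;
  bip_add : forall A B, borel A -> borel B -> A `&` B = set0 ->
     m (A `|` B) = m A + m B;
  bip_setT : m setT = 1;
  bip_left_invariant : forall g A, borel A -> m (mul g @` A) = m A }.

(** * From sigma-additive Haar measure to a finitely additive real-valued one *)

Section HaarProb.
Context {R : realType} {T : topologicalType} {mul : T -> T -> T}.
Context {mu : set T -> \bar R} (hmu : haar_prob mul mu).

(** Sigma-additivity for [setT, set0, set0, ...] gives a limit equal to 1, while the partial sums
    are eventually at least [1 + mu set0]. *)
Lemma haar_prob_set0 : mu set0 = 0%E.
Proof.
have mu0 : (0 <= mu set0)%E by apply: hp_ge0 hmu _ _; exact: borel0.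
pose F (i : nat) : set T := if i is 0 then setT else set0.
have /(hp_sigma_additive hmu) : forall i, borel (F i).
  by case=> [|i]; [exact: borelT|exact: borel0].
have FT : \bigcup_i F i = setT by apply/seteqP; split=> // x _; exists 0%N.
have /[swap]/[apply] : trivIset setT F.
  by move=> [|i] [|j] _ _ [x []].
rewrite FT (hp_setT hmu) => cvg1.
have := cvg_lim (@ereal_hausdorff R) cvg1 => lim1.
have : (1 + mu set0 <= 1)%E.
  rewrite -[leRHS]lim1; apply: lime_ge; first by apply/cvg_ex; exists 1%E.
  exists 2%N => // -[|[|n]] //= _.
  rewrite 2?big_nat_recl//= (hp_setT hmu) leeD2l// leeDl//.
  by apply: sume_ge0 => i _.
case: (mu set0) mu0 => [r| |]//; rewrite !lee_fin => r0 r1.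
by congr (_%:E); apply/eqP; rewrite eq_le r0 andbT; lra.
Qed.

Lemma haar_prob_setU A B : borel A -> borel B -> A `&` B = set0 ->
  mu (A `|` B) = (mu A + mu B)%E.
Proof.
move=> bA bB AB0.
have /(hp_sigma_additive hmu) : forall i, borel (bigcup2 A B i).
  by case=> [|[|i]] //=; exact: borel0.
have /[swap]/[apply] : trivIset setT (bigcup2 A B).
  by rewrite -trivIset_bigcup2.
rewrite bigcup2E => cvgU; apply: (cvg_unique (@ereal_hausdorff R) cvgU).
apply: cvg_near_cst; exists 2%N => // -[|[|n]] //= _.
rewrite 2?big_nat_recl//= big1 ?adde0// => i _; exact: haar_prob_set0.
Qed.

Lemma haar_prob_fineK A : borel A -> (fine (mu A))%:E = mu A.
Proof.
move=> bA; apply: fineK; rewrite ge0_fin_numE; last exact: hp_ge0 hmu _ bA.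
apply: (@le_lt_trans _ _ 1%E); last exact: ltry.
rewrite -(hp_setT hmu) -(setUv A) haar_prob_setU ?setICr//; last exact: borelC.
by rewrite leeDl//; apply: (hp_ge0 hmu); exact: borelC.
Qed.

Lemma haar_prob_borel_invariant : borel_invariant_prob mul (fine \o mu).
Proof.
split=> [A bA|A B bA bB AB0||g A bA] /=.
- by apply: fine_ge0; exact: hp_ge0 hmu _ bA.
- by rewrite haar_prob_setU// -(haar_prob_fineK bA) -(haar_prob_fineK bB).
- by rewrite (hp_setT hmu).
- by rewrite (hp_left_invariant hmu).
Qed.

End HaarProb.

(** * Calculus of finitely additive invariant probabilities *)

Section InvariantProb.
Context {R : realType} {T : topologicalType} {mul : T -> T -> T}.
Context {m : set T -> R} (hm : borel_invariant_prob mul m).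

Lemma bip_set0 : m set0 = 0.
Proof.
have := bip_add hm (@borel0 T) (@borel0 T) (setI0 _).
by rewrite setU0 => ?; lra.
Qed.

Lemma bip_splitI A B : borel A -> borel B -> m A = m (A `&` B) + m (A `\` B).
Proof.
move=> bA bB; rewrite -(bip_add hm) ?setUIDK//.
- exact: borelI.
- exact: borelD.
- by rewrite setDE setIACA setICr setI0.
Qed.

Lemma bip_le A B : borel A -> borel B -> A `<=` B -> m A <= m B.
Proof.
move=> bA bB AB; rewrite (bip_splitI bB bA) (setIidr AB) lerDl.
by apply: (bip_ge0 hm); exact: borelD.
Qed.

Lemma bip_setC A : borel A -> m (~` A) = 1 - m A.
Proof.
move=> bA; rewrite -(bip_setT hm) (bip_splitI (@borelT T) bA).
by rewrite setTI setTD; lra.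
Qed.

(* Splitting along the first set of the list avoids integrating a simple
   function. *)
Lemma bip_sum_indic_le (l : seq (R * set T)) (S : set T) (c : R) :
  (forall p, p \in l -> borel p.2) -> borel S ->
  (forall x, S x -> \sum_(p <- l) p.1 * (`[< p.2 x >])%:R <= c) ->
  \sum_(p <- l) p.1 * m (p.2 `&` S) <= c * m S.
Proof.
(* With no terms left, [c] is known to be nonnegative only if [S] has a point; otherwise
   [m S = 0]. *)
elim: l S c => [|[a B] l IH] S c bl bS lec.
  rewrite big_nil; have [->|/set0P[x Sx]] := eqVneq S set0.
    by rewrite bip_set0 mulr0.
  rewrite mulr_ge0//; last exact: bip_ge0 hm _ bS.
  by have := lec x Sx; rewrite big_nil.
have bB : borel B by apply: (bl (a, B)); rewrite mem_head.
have bl' p : p \in l -> borel p.2 by move=> pl; apply: bl; rewrite inE pl orbT.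
rewrite big_cons/=.
(* On [B] the head term contributes exactly [a], so the tail is bounded by [c - a]; off [B] it
   contributes nothing. *)
have IH1 : \sum_(p <- l) p.1 * m (p.2 `&` (S `&` B)) <= (c - a) * m (S `&` B).
  apply: IH => //; first exact: borelI.
  by move=> x [Sx Bx]; have := lec x Sx; rewrite big_cons/= asboolT//=; lra.
have IH2 : \sum_(p <- l) p.1 * m (p.2 `&` (S `\` B)) <= c * m (S `\` B).
  apply: IH => //; first exact: borelD.
  by move=> x [Sx Bx]; have := lec x Sx; rewrite big_cons/= asboolF//=; lra.
have -> : \sum_(p <- l) p.1 * m (p.2 `&` S) =
    \sum_(p <- l) p.1 * m (p.2 `&` (S `&` B)) +
    \sum_(p <- l) p.1 * m (p.2 `&` (S `\` B)).
  rewrite -big_split/=; apply: eq_big_seq => p /bl' bp.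
  by rewrite (bip_splitI (borelI bp bS) bB) -setIA setIDA mulrDr.
by rewrite (bip_splitI bS bB) setIC; lra.
Qed.

End InvariantProb.

(** * Halving by translations *)

Section Translation.
Context {R : realType} {T : topologicalType} {mul : T -> T -> T}.
Context {inv : T -> T} {e : T} (hT : compact_group mul inv e).

(* Over each piece of the disjointified cover, [A] and its translate by [t i]
   are disjoint, and the translation preserves the piece. *)
Lemma bip_translate_le (m : set T -> R) (A : set T) (I : eqType)
    (D : I -> set T) (t : I -> T) (s : seq I) :
  borel_invariant_prob mul m -> borel A -> (forall i, borel (D i)) ->
  (forall i j x, D j (mul (t i) x) <-> D j x) ->
  (forall i x, A x -> D i x -> ~ A (mul (t i) x)) ->
  exists U, [/\ borel U, (forall x, U x <-> exists2 i, i \in s & D i x) &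
    2 * m (A `&` U) <= m U].
Proof.
move=> hm bA bD Dt AD; elim: s => [|i s [U [bU UP leU]]].
  exists set0; split; first exact: borel0.
    by move=> x; split=> // -[].
  by rewrite setI0 (bip_set0 hm) mulr0.
exists (D i `|` U); split; first exact: borelU.
  move=> x; split=> [[Dx|/UP[j js Dx]]|[j]].
  - by exists i => //; rewrite mem_head.
  - by exists j => //; rewrite inE js orbT.
  - by rewrite inE => /orP[/eqP ->|js] Dx; [left|right; apply/UP; exists j].
set E := D i `\` U; have bE : borel E by exact: borelD.
have bAE : borel (A `&` E) by exact: borelI.
(* Translation by [t i] maps [A] inside the new piece [E] into the rest of [E]: every [D j], hence
   also [U], is invariant under it. *)
have leE : m (A `&` E) <= m (E `\` A).
  rewrite -(bip_left_invariant hm (t i) bAE); apply: (bip_le hm).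
  - exact: borel_image_mul hT _ _ bAE.
  - exact: borelD.
  - move=> _ [x [Ax [Dx Ux]] <-]; split; last exact: AD.
    split; first exact/Dt.
    by move=> /UP[j js /Dt Djx]; apply: Ux; apply/UP; exists j.
have mE := bip_splitI hm bE bA.
have bV : borel (D i `|` U) by exact: borelU.
rewrite (bip_splitI hm bV bU) (bip_splitI hm (borelI bA bV) bU).
rewrite -setIA -setIDA (_ : _ `&` U = U); last by rewrite setIC setKU.
by rewrite setDUD setDv setU0 -/E; move: mE leE; rewrite [E `&` A]setIC; lra.
Qed.

(** A compact [K] outside [B] is covered by finitely many [D i], on whose union [A] fills at most
    half of the mass; inner regularity then lets [K] exhaust the complement of [B]. *)
Lemma haar_half (mu : set T -> \bar R) (A B : set T) (I : eqType)
    (D : I -> set T) (t : I -> T) :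
  haar_prob mul mu -> borel A -> closed B -> (forall i, open (D i)) ->
  (forall i j x, D j (mul (t i) x) <-> D j x) ->
  (forall i x, A x -> D i x -> ~ A (mul (t i) x)) ->
  (forall x, ~ B x -> exists i, D i x) ->
  2 * fine (mu A) <= 1 + fine (mu B).
Proof.
move=> hmu bA cB oD Dt AD BD; have hm := haar_prob_borel_invariant hmu.
have bB : borel B by exact: borel_closed.
(* If [U] is the finite union covering [K], then [mu A <= mu U / 2 + (1 - mu U)], that is,
   [mu U <= 2 - 2 mu A]. *)
have leK K : compact K -> K `<=` ~` B -> fine (mu K) <= 2 - 2 * fine (mu A).
  move=> cK KB; have [|s sK] := @compact_seq_cover _ _ _ _ cK oD.
    by move=> x /KB /BD.
  have bD i : borel (D i) by exact: borel_open.
  have [U [bU UP leU]] := @bip_translate_le _ _ _ _ t s hm bA bD Dt AD.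
  have KU : fine (mu K) <= fine (mu U).
    apply: (bip_le hm) => //.
      by apply: borel_closed; exact: cg_compact_closed hT _ cK.
    by move=> x /sK[i si Dix]; apply/UP; exists i.
  have AU := bip_splitI hm bA bU.
  have : fine (mu (A `\` U)) <= fine (mu (~` U)).
    by apply: (bip_le hm); [exact: borelD|exact: borelC|apply: subIsetr].
  have /= := bip_setC hm bU.
  move: leU AU => /=; lra.
suff : fine (mu (~` B)) <= 2 - 2 * fine (mu A).
  by have /= := bip_setC hm bB; lra.
rewrite -lee_fin (haar_prob_fineK hmu); last exact: borelC.
rewrite (hp_inner_regular hmu); last exact: closed_openC.
apply: ub_ereal_sup => _ [K [cK KB] <-].
rewrite -(haar_prob_fineK hmu) ?lee_fin; first exact: leK.
by apply: borel_closed; exact: cg_compact_closed hT _ cK.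
Qed.
End Translation.

(** * One-sided uniqueness of Haar measure, on closed sets *)

Section HaarUnique.
Context {R : realType} {T : topologicalType} {mul : T -> T -> T}.
Context {inv : T -> T} {e : T} (hT : compact_group mul inv e).

Let idc : continuous (@id T).
Proof. by move=> x; exact: cvg_id. Qed.

Let cstc (a : T) : continuous (fun _ : T => a).
Proof. by move=> x; exact: cst_continuous. Qed.

Lemma open_inv (U : set T) : open U -> open (inv @^-1` U).
Proof. exact: (continuousP _).1 (cg_inv_cont hT) U. Qed.

(** A tube argument: at [z = y] the product is [t], which lies in [U], and compactness of [C] makes
    the neighbourhood of [y] uniform in [t]. *)
Lemma open_translate_nbhs (C U : set T) (y : T) :
  closed C -> open U -> C `<=` U ->
  nbhs y [set z | forall t, C t -> U (mul (mul (inv z) y) t)].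
Proof.
move=> cC oU CU.
have := (compact_near_coveringP C).1 (cg_closed_compact hT cC) _ (nbhs y)
  (fun z t => U (mul (mul (inv z) y) t)) _; apply=> t Ct.
have cg : continuous (fun p : T * T => mul (mul (inv p.2) y) p.1).
  apply: (continuous_mul hT); last by move=> p; exact: cvg_fst.
  apply: (continuous_mul hT); last by move=> p; exact: cst_continuous.
  by apply: (continuous_inv hT) => p; exact: cvg_snd.
have := cg (t, y) U; apply; rewrite /= (cg_mulVg hT) (cg_mul1g hT).
by apply: open_nbhs_nbhs; split=> //; exact: CU.
Qed.

Section FiniteFubini.
Context {m nu : set T -> R}.
Context (hm : borel_invariant_prob mul m) (hnu : borel_invariant_prob mul nu).
Variables (C U : set T) (O : T -> set T).
Hypotheses (bC : borel C) (oU : open U) (oO : forall y, open (O y)).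
Hypothesis OCU : forall y z t, O y z -> C t -> U (mul (mul (inv z) y) t).

Let S x : set T := [set z | U (mul (inv z) x)].

Let oS x : open (S x).
Proof.
apply: (continuousP (fun z => mul (inv z) x)).1 => //.
by apply: (continuous_mul hT) => //; exact: (continuous_inv hT).
Qed.

(* The rectangles [E y * (y C)], with [E y] the disjointified [O y], lie inside
   [{(z, x) | z^-1 x \in U}]: the first list entry is [m (E y)], the second
   [y C]. *)
Lemma rectangles_in_sections (s : seq T) :
  exists W l, [/\ borel W, (forall x, W x <-> exists2 y, y \in s & O y x),
    (forall p, p \in l -> borel p.2),
    \sum_(p <- l) p.1 * nu p.2 = nu C * m W &
    forall x, \sum_(p <- l) p.1 * (`[< p.2 x >])%:R <= m (W `&` S x)].
Proof.
elim: s => [|y s [W [l [bW WP bl suml lel]]]].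
  exists set0, [::]; split=> //.
  - exact: borel0.
  - by move=> x; split=> // -[].
  - by rewrite big_nil (bip_set0 hm) mulr0.
  - by move=> x; rewrite big_nil set0I (bip_set0 hm).
have bO : borel (O y) by exact: borel_open.
have bV : borel (O y `|` W) by exact: borelU.
have bS x : borel (S x) by exact: borel_open.
have VW : (O y `|` W) `\` W = O y `\` W by rewrite setDUD setDv setU0.
have WV : (O y `|` W) `&` W = W by rewrite setIC setKU.
exists (O y `|` W), ((m (O y `\` W), mul y @` C) :: l); split=> //.
- move=> x; split=> [[Ox|/WP[z zs Oz]]|[z]].
  + by exists y => //; rewrite mem_head.
  + by exists z => //; rewrite inE zs orbT.
  + by rewrite inE => /orP[/eqP ->|zs] Oz; [left|right; apply/WP; exists z].
- move=> p; rewrite inE => /orP[/eqP ->|/bl//].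
  exact: borel_image_mul hT _ _ bC.
- rewrite big_cons/= suml (bip_left_invariant hnu)//.
  by rewrite (bip_splitI hm bV bW) VW WV; lra.
- move=> x; rewrite big_cons/=.
  have := lel x.
  have bVS : borel ((O y `|` W) `&` S x) by exact: borelI.
  rewrite (bip_splitI hm bVS bW) setIAC WV.
  rewrite [(_ `&` S x) `\` W]setDE setIAC -setDE VW.
  have bE : borel (O y `\` W) by exact: borelD.
  have bES : borel ((O y `\` W) `&` S x) by exact: borelI.
  case: asboolP => [[t Ct <-]|_] /=; last first.
    by have := bip_ge0 hm bES; lra.
  (* For [x = y t] with [t] in [C], each [z] in [O y] has [z^-1 x] in [U], so the whole piece lies
     in the section [S x]. *)
  rewrite (_ : (O y `\` W) `&` _ = O y `\` W); first by lra.
  by apply: setIidl => z [Oz _]; rewrite /S /= (cg_assoc hT); exact: OCU Oz Ct.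
Qed.

End FiniteFubini.

(** Once the [O y] cover the group, the packed rectangles have total mass [nu C], while each section
    at [x] has [m]-mass at most that of [x U^-1], which is [m U^-1] by invariance. *)
Lemma bip_closed_le_inv_open (m nu : set T -> R) (C U : set T) :
  borel_invariant_prob mul m -> borel_invariant_prob mul nu ->
  closed C -> open U -> C `<=` U -> nu C <= m (inv @^-1` U).
Proof.
move=> hm hnu cC oU CU.
pose O y := [set z | forall t, C t -> U (mul (mul (inv z) y) t)]^°.
have oO y : open (O y) by exact: open_interior.
have OCU y z t : O y z -> C t -> U (mul (mul (inv z) y) t).
  by move=> /interior_subset; apply.
have [|s sT] := compact_seq_cover (cg_compact hT) oO.
  by move=> y _; exists y; exact: open_translate_nbhs.
have bC : borel C by exact: borel_closed.
have [W [l [bW WP bl suml lel]]] :=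
  rectangles_in_sections hm hnu bC oU oO OCU s.
have WT : W = setT by apply/seteqP; split=> // x _; exact: (WP x).2 (sT x I).
move: suml; rewrite WT (bip_setT hm) mulr1 => <-.
have bU : borel (inv @^-1` U).
  by apply: borel_open; exact: open_inv.
have := @bip_sum_indic_le _ _ _ _ hnu l setT (m (inv @^-1` U)) bl (@borelT T).
rewrite (bip_setT hnu) mulr1; under eq_bigr do rewrite setIT.
apply=> x _; apply: le_trans (lel x) _; rewrite WT setTI.
(* The section of all [z] with [z^-1 x] in [U] is the left translate [x U^-1]. *)
rewrite -(bip_left_invariant hm x bU) (cg_image_mul hT).
rewrite (_ : mul (inv x) @^-1` _ = [set z | U (mul (inv z) x)])//.
by apply/seteqP; split=> z /=; rewrite (cg_invM hT) (cg_invK hT).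
Qed.

(** For compact [K] inside [U^-1], the previous comparison with both measures equal bounds [mu K] by
    the measure of [(U^-1)^-1 = U]. *)
Lemma haar_inv_open_le (mu : set T -> \bar R) (U : set T) :
  haar_prob mul mu -> open U -> fine (mu (inv @^-1` U)) <= fine (mu U).
Proof.
move=> hmu oU; have hm := haar_prob_borel_invariant hmu.
have oV := open_inv oU.
rewrite -lee_fin (haar_prob_fineK hmu); last exact: borel_open.
rewrite (hp_inner_regular hmu)//; apply: ub_ereal_sup => _ [K [cK KV] <-].
have cK' := cg_compact_closed hT cK.
rewrite -(haar_prob_fineK hmu) ?lee_fin; last exact: borel_closed.
have := bip_closed_le_inv_open hm hm cK' oV KV.
rewrite /= (_ : inv @^-1` _ = U)//.
by apply/seteqP; split=> x /=; rewrite (cg_invK hT).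
Qed.

Lemma haar_unique_closed_le (mu : set T -> \bar R) (nu : set T -> R)
    (C : set T) :
  haar_prob mul mu -> borel_invariant_prob mul nu -> closed C ->
  nu C <= fine (mu C).
Proof.
move=> hmu hnu cC; have hm := haar_prob_borel_invariant hmu.
have bC : borel C by exact: borel_closed.
rewrite -lee_fin (haar_prob_fineK hmu)// (hp_outer_regular hmu)//.
apply: le_ereal_inf_tmp => _ [U [oU CU] <-].
rewrite -(haar_prob_fineK hmu) ?lee_fin; last exact: borel_open.
apply: le_trans (haar_inv_open_le hmu oU).
exact: bip_closed_le_inv_open hm hnu cC oU CU.
Qed.

End HaarUnique.

(** * Powers of a compact group, the upper central series and iterated commutators *)

Section ProductGroup.
Context {T : topologicalType} {mul : T -> T -> T} {inv : T -> T} {e : T}.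
Hypothesis hT : compact_group mul inv e.

Lemma compact_group_ptws (k : nat) :
  compact_group (pw_mul (k := k) mul)
    ((fun f i => inv (f i)) : {ptws 'I_k -> T} -> {ptws 'I_k -> T}) (fun=> e).
Proof.
have coord i := @ptws_coord_continuous T 'I_k i.
split.
- by move=> x y z; apply/funext => i; exact: cg_assoc hT _ _ _.
- by move=> x; apply/funext => i; exact: cg_mul1g hT _.
- by move=> x; apply/funext => i; exact: cg_mulVg hT _.
- apply: continuous_to_ptws => i; apply: (continuous_mul hT) => p.
    apply: (@continuous_comp _ _ _ fst (fun f : {ptws 'I_k -> T} => f i)).
      exact: cvg_fst.
    exact: coord.
  apply: (@continuous_comp _ _ _ snd (fun f : {ptws 'I_k -> T} => f i)).
    exact: cvg_snd.
  exact: coord.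
- by apply: continuous_to_ptws => i; apply: (continuous_inv hT); exact: coord.
- exact: (@hausdorff_product 'I_k (fun=> T) (fun=> cg_hausdorff hT)).
- have := @tychonoff 'I_k (fun=> T) (fun=> setT) (fun=> cg_compact hT).
  by rewrite (_ : [set _ | _] = setT)//; apply/seteqP; split.
Qed.

Local Notation comm := (comm mul inv).
Local Notation Z := (upper_central mul inv e).

(** The four closure properties go through one induction, since the commutator identities for
    products and inverses produce conjugates in the previous term. *)
Lemma upper_central_normal_subgroup n :
  [/\ Z n e, (forall x y, Z n x -> Z n y -> Z n (mul x y)),
    (forall x, Z n x -> Z n (inv x)) &
    forall x g, Z n x -> Z n (mul (inv g) (mul x g))].
Proof.
elim: n => [|n [Z1 ZM ZV ZJ]].
  split=> //=.
  - by move=> x y -> ->; rewrite (cg_simp hT).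
  - by move=> x ->; rewrite (cg_simp hT).
  - by move=> x g ->; rewrite !(cg_simp hT).
split=> [y|x y Zx Zy z|x Zx z|x g Zx z] /=.
- by rewrite /Defs.comm !(cg_simp hT).
- have -> : comm (mul x y) z =
      mul (mul (inv y) (mul (comm x z) y)) (comm y z).
    by rewrite /Defs.comm !(cg_simp hT).
  by apply: ZM => //; exact: ZJ.
- have -> : comm (inv x) z =
      mul (inv (inv x)) (mul (inv (comm x z)) (inv x)).
    by rewrite /Defs.comm !(cg_simp hT).
  by apply: ZJ; exact: ZV.
- have -> : comm (mul (inv g) (mul x g)) z =
      mul (inv g) (mul (comm x (mul g (mul z (inv g)))) g).
    by rewrite /Defs.comm !(cg_simp hT).
  exact: ZJ.
Qed.

Lemma upper_central_closed n : closed (Z n).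
Proof.
elim: n => [|n IH] /=.
  exact/accessible_closed_set1/hausdorff_accessible/(cg_hausdorff hT).
rewrite (_ : [set _ | _] = \bigcap_y ((fun x => comm x y) @^-1` Z n)).
  apply: closed_bigI => y _; apply: (continuous_closedP _).1 => //.
  apply: (continuous_comm hT) => x; first exact: cvg_id.
  exact: cst_continuous.
by apply/seteqP; split=> x /= Zx y => [_|]; [exact: Zx|exact: (Zx y)].
Qed.

(** Solves [[c, g x] = [c, x] [c, g]^x] for [[c, g]]. Contrapositively, if [[c, g]] is outside the
    central term, [x] and [g x] cannot both give commutators in it. *)
Lemma upper_central_comm_translate n c g x :
  Z n (comm c x) -> Z n (comm c (mul g x)) -> Z n (comm c g).
Proof.
have [_ ZM ZV ZJ] := upper_central_normal_subgroup n => Zx Zgx.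
have -> : comm c g = mul (inv (inv x)) (mul (mul (inv (comm c x))
    (comm c (mul g x))) (inv x)).
  by rewrite /Defs.comm !(cg_simp hT).
by apply: ZJ; apply: ZM => //; exact: ZV.
Qed.

Lemma itcomm_eq k (x y : nat -> T) : (forall i, (i <= k)%N -> x i = y i) ->
  itcomm mul inv k x = itcomm mul inv k y.
Proof.
elim: k => [|k IH] xy /=; first exact: xy.
by rewrite IH ?xy// => i ik; apply: xy; exact: leqW.
Qed.

Lemma itcomm_continuous d k :
  continuous (fun x : {ptws 'I_d.+1 -> T} =>
    itcomm mul inv k (fun i => x (inord i))).
Proof.
have coord i := @ptws_coord_continuous T 'I_d.+1 i.
by elim: k => [|k IH] /=; [exact: coord|apply: (continuous_comm hT)].
Qed.

End ProductGroup.

(** * The halving inequality along the central series *)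

Section Halving.
Context {R : realType} {G : topologicalType} {mul : G -> G -> G}.
Context {inv : G -> G} {e : G} (hG : compact_group mul inv e) {d : nat}.
Context {mu : set {ptws 'I_d.+1 -> G} -> \bar R}.
Hypothesis hmu : haar_prob (pw_mul mul) mu.

Definition itcomm_central k n : set {ptws 'I_d.+1 -> G} :=
  [set x | upper_central mul inv e n (itcomm mul inv k (fun i => x (inord i)))].

Lemma itcomm_central_closed k n : closed (itcomm_central k n).
Proof.
apply: (continuous_closedP _).1; first exact: itcomm_continuous hG _ _.
exact: upper_central_closed hG _.
Qed.

(** Coordinate [k.+1] is translated by [g]; the open set [D g] depends only on coordinates up to
    [k], so every such translation preserves it. *)
Lemma itcomm_central_halving k n : (k < d)%N ->
  2 * fine (mu (itcomm_central k.+1 n)) <=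
  1 + fine (mu (itcomm_central k n.+1)).
Proof.
move=> kd.
pose c (x : {ptws 'I_d.+1 -> G}) := itcomm mul inv k (fun i => x (inord i)).
pose t g : {ptws 'I_d.+1 -> G} := fun i => if i == inord k.+1 then g else e.
have ct g x : c (pw_mul mul (t g) x) = c x.
  apply: itcomm_eq => i ik; rewrite /pw_mul /t ifF ?(cg_mul1g hG)//.
  apply/negbTE/eqP => /(congr1 (@nat_of_ord _)).
  by rewrite !inordK ?ltnS//; [lia|lia].
pose D g : set {ptws 'I_d.+1 -> G} :=
  [set x | ~ upper_central mul inv e n (comm mul inv (c x) g)].
apply: (haar_half (compact_group_ptws hG d.+1) (D := D) (t := t) hmu).
- by apply: borel_closed; exact: itcomm_central_closed.
- exact: itcomm_central_closed.
- move=> g; apply: closed_openC.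
  apply: (continuous_closedP (fun x => comm mul inv (c x) g)).1.
    apply: (continuous_comm hG); first exact: itcomm_continuous hG _ _.
    by move=> x; exact: cst_continuous.
  exact: upper_central_closed hG _.
- by move=> g h x; rewrite /D /= ct.
- move=> g x Ax Dx; rewrite /itcomm_central /= -/(c _) ct => Agx; apply: Dx.
  apply: (upper_central_comm_translate hG Ax).
  by move: Agx; rewrite {1}/pw_mul /t eqxx.
(* By definition of the next central term, a commutator outside it has some [g] witnessing this. *)
- by move=> x /existsNP.
Qed.

End Halving.

(** * Pushforward along a surjective morphism *)

Section Pushforward.
Context {G H : topologicalType}.
Context {mulG : G -> G -> G} {invG : G -> G} {eG : G}.
Context {mulH : H -> H -> H} {invH : H -> H} {eH : H}.
Hypotheses (hG : compact_group mulG invG eG) (hH : compact_group mulH invH eH).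
Variable f : G -> H.
Hypothesis fM : forall x y, f (mulG x y) = mulH (f x) (f y).

Lemma cg_morph1 : f eG = eH.
Proof.
by apply: (cg_mulgI hH (x := f eG)); rewrite -fM (cg_mul1g hG) (cg_mulg1 hH).
Qed.

Lemma cg_morphV x : f (invG x) = invH (f x).
Proof.
apply: (cg_mulgI hH (x := f x)).
by rewrite -fM (cg_mulgV hG) (cg_mulgV hH) cg_morph1.
Qed.

Lemma cg_morph_comm x y : f (comm mulG invG x y) = comm mulH invH (f x) (f y).
Proof. by rewrite /comm !fM !cg_morphV. Qed.

(** Surjectivity turns translation by [h] into translation by any [g] above [h], whence left
    invariance. *)
Lemma bip_pushforward (R : realType) (m : set G -> R) :
  borel_invariant_prob mulG m -> continuous f ->
  (forall h, exists x, f x = h) ->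
  borel_invariant_prob mulH (fun A => m (f @^-1` A)).
Proof.
move=> hm cf fsurj; have bf A := @borel_preimage _ _ f A cf.
split=> [A bA|A B bA bB AB0||h A bA].
- exact: bip_ge0 hm _ (bf _ bA).
- rewrite preimage_setU (bip_add hm (bf _ bA) (bf _ bB))//.
  by rewrite -preimage_setI AB0 preimage_set0.
- by rewrite preimage_setT (bip_setT hm).
- have [g <-] := fsurj h; rewrite -(bip_left_invariant hm g (bf _ bA)).
  congr m; rewrite (cg_image_mul hG) (cg_image_mul hH).
  by apply/seteqP; split=> x /=; rewrite fM cg_morphV.
Qed.

End Pushforward.

(** * Iterated halving and passage to the quotient *)

Theorem theorem3p4 (R : realType)
  (G : topologicalType) (mulG : G -> G -> G) (invG : G -> G) (eG : G)
  (hG : compact_group mulG invG eG)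
  (n : nat) (hn : (1 <= n)%N)
  (Q : topologicalType) (mulQ : Q -> Q -> Q) (invQ : Q -> Q) (eQ : Q)
  (hQ : compact_group mulQ invQ eQ)
  (pi : G -> Q)
  (pi_morph : forall x y, pi (mulG x y) = mulQ (pi x) (pi y))
  (pi_cont : continuous pi)
  (pi_open : forall U : set G, open U -> open (pi @` U))
  (pi_surj : forall q : Q, exists x : G, pi x = q)
  (pi_ker : pi @^-1` [set eQ] = upper_central mulG invG eG n)
  (muG : set {ptws 'I_n.+2 -> G} -> \bar R)
  (hmuG : haar_prob (pw_mul mulG) muG)
  (muQ : set {ptws 'I_2 -> Q} -> \bar R)
  (hmuQ : haar_prob (pw_mul mulQ) muQ) :
  (muG (comm_trivial_set mulG invG eG n.+1)
   <= ((2%:R ^- n : R)%:E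
       * ((2%:R ^+ n - 1 : R)%:E + muQ (comm_trivial_set mulQ invQ eQ 1))))%E.
Proof.
pose A k : set {ptws 'I_n.+2 -> G} :=
  itcomm_central (mul := mulG) (inv := invG) (e := eG) (n.+1 - k) k.
(* The inductive step doubles the bound and uses [2 mu A_k <= 1 + mu A_(k+1)], as
   [2 (2^k - 1) + 1 = 2^(k+1) - 1]. *)
have halve k : (k <= n)%N ->
    2 ^+ k * fine (muG (A 0%N)) <= 2 ^+ k - 1 + fine (muG (A k)).
  elim: k => [_|k IH kn]; first by rewrite expr0; lra.
  have kn1 : (n - k < n.+1)%N by lia.
  have := itcomm_central_halving hG hmuG k kn1.
  rewrite -subSn ?(ltnW kn)// -/(A k).
  rewrite (_ : itcomm_central _ _ = A k.+1); last by rewrite /A subSS.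
  by have := IH (ltnW kn); rewrite exprS; lra.
(* Only the first two coordinates are kept: [A n] requires just their commutator to lie in the
   kernel of [pi]. *)
pose phi (x : {ptws 'I_n.+2 -> G}) : {ptws 'I_2 -> Q} :=
  fun i => pi (x (inord i)).
pose C := comm_trivial_set mulQ invQ eQ 1.
have cC : closed C.
  exact: (@itcomm_central_closed _ _ _ _ hQ 1 1 0).
have AC : A n = phi @^-1` C.
  rewrite /A /C /comm_trivial_set /itcomm_central subSnn -pi_ker.
  apply/seteqP; split=> x /=; rewrite (cg_morph_comm hG hQ pi_morph) /phi;
  by rewrite !inordK.
have hGn := compact_group_ptws hG n.+2; have hQ2 := compact_group_ptws hQ 2.
have phic : continuous phi.
  apply: continuous_to_ptws => i x.
  apply: (@continuous_comp _ _ _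
    (fun x : {ptws 'I_n.+2 -> G} => x (inord i)) pi).
    exact: ptws_coord_continuous.
  exact: pi_cont.
have phiM x y : phi (pw_mul mulG x y) = pw_mul mulQ (phi x) (phi y).
  by apply/funext => i; exact: pi_morph.
have phi_surj q : exists x, phi x = q.
  have [lift liftK] := choice pi_surj.
  (* Beyond the first two coordinates [inord] takes its default value; [phi] does not see those
     entries. *)
  exists (fun i => lift (q (inord i))); apply/funext => i.
  rewrite /phi liftK; congr q; apply: val_inj.
  by rewrite /= !inordK// ltnS; have := ltn_ord i; lia.
have AnC : fine (muG (A n)) <= fine (muQ C).
  have hm := haar_prob_borel_invariant hmuG.
  have := haar_unique_closed_le hQ2 hmuQ
    (bip_pushforward hGn hQ2 phiM hm phic phi_surj) cC.
  by rewrite AC.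
have -> : comm_trivial_set mulG invG eG n.+1 = A 0%N by [].
have bA : borel (A 0%N).
  by apply: borel_closed;
     exact: (@itcomm_central_closed _ _ _ _ hG n.+1 n.+1 0).
have bC : borel C by exact: borel_closed.
rewrite -(haar_prob_fineK hmuG bA) -(haar_prob_fineK hmuQ bC).
rewrite -EFinD -EFinM lee_fin ler_pdivlMl ?exprn_gt0//.
by apply: le_trans (halve n (leqnn n)) _; rewrite lerD2l.
Qed.
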